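(* Let $N\ge 2$, let $i^*$ be the (unique) maximum-throughput channel, assume $p_{i^*}<1$, and let $m_i = p_i/p_{i^*}$ for $i\in\mathcal N\setminus\{i^*\}$. Consider a file of size $F\in(k\Delta r_{i^*},(k+1)\Delta r_{i^*})$ for some integer $k\ge 0$. Then $$\frac{\mathbb E[T(i_{so},F)]}{\mathbb E[T(i^*,F)]}\ \le\ \min_{i\in\mathcal N\setminus\{i^*\}}\left\{1,\ \frac{F/(\Delta r_ip_i)+(1-p_i)/p_i}{(k+1)(m_i/p_i-1)}\right\},$$ where $\mathbb E[T(i_{so},F)]=\min_{j\in\mathcal N}\mathbb E[T(j,F)]$ is the expected transfer time of the static optimal policy.
   Context: There is a finite set of channels $\mathcal N=\{1,\dots,N\}$ and a fixed slot length $\Delta>0$. Channel $i$ has rate $r_i>0$ and availability probability $p_i\in(0,1]$. For each $i\in\mathcal N$, $\{Y_i(k)\}_{k=0,1,2,\dots}$ is an i.i.d. Bernoulli sequence with $P[Y_i(k)=1]=p_i=1-P[Y_i(k)=0]$, and these sequences are independent over channels. The state of channel $i$ at real time $t\ge 0$ is $X_i(t)=Y_i(\lfloor t/\Delta\rfloor)$. The static policy on channel $i$ uses channel $i$ at all times, and its transfer time for a file of size $F$ is the random variable $$T(i,F)=\min\Big\{T\ge 0:\ \int_0^{T} r_iX_i(t)\,dt\ \ge F\Big\}.$$ The throughput of channel $i$ is $r_ip_i$; $i^*=\arg\max_{k\in\mathcal N}r_kp_k$ is assumed unique: $r_{i^*}p_{i^*}>r_kp_k$ for all $k\in\mathcal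 N\setminus\{i^*\}$. A static optimal channel is $i_{so}=i_{so}(F)\in\arg\min_{k\in\mathcal N}\mathbb E[T(k,F)]$. The notation $\min_{i}\{1,a_i\}$ means the minimum of $1$ and all the numbers $a_i$. *)

(* Defs.v *)
From HB Require Import structures.
From mathcomp Require Import all_boot all_order all_algebra.
From mathcomp Require Import all_classical all_reals all_analysis.

Set Implicit Arguments.
Unset Strict Implicit.
Unset Printing Implicit Defensive.

Import Order.TTheory GRing.Theory Num.Theory.
Import numFieldNormedType.Exports.

Local Open Scope classical_set_scope.
Local Open Scope ring_scope.

Definition mutually_independent (R : realType) (d d' : measure_display)
    (Omega : measurableType d) (S : measurableType d') (P : probability Omega R)
    (I : choiceType) (X : I -> {RV P >-> S}) : Prop :=
  forall (J : seq I) (A : I -> set S), uniq J ->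
    (forall i, measurable (A i)) ->
    P (\bigcap_(i in [set` J]) (X i @^-1` A i)) =
    (\prod_(i <- J) P (X i @^-1` A i))%E.

(* Independence is over all pairs (channel, slot) at once: it covers both
   independence in time on each channel and independence across channels. *)
Definition iid_bernoulli_channels (R : realType) (d : measure_display)
    (Omega : measurableType d) (P : probability Omega R) (N : nat)
    (p : 'I_N -> R) (Y : 'I_N -> nat -> {RV P >-> bool}) : Prop :=
  (forall i n, P [set w | Y i n w = true] = (p i)%:E /\
               P [set w | Y i n w = false] = (1 - p i)%:E) /\
  mutually_independent (fun c : 'I_N * nat => Y c.1 c.2).

Section channels.
Variables (R : realType) (d : measure_display) (Omega : measurableType d).
Variables (P : probability Omega R) (N : nat).
Variables (Delta : R) (r : 'I_N -> R).
Variable Y : 'I_N -> nat -> {RV P >-> bool}.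

(* [Num.truncn] is the floor on nonnegative reals, the only times used. *)
Definition channel_state (i : 'I_N) (t : R) (w : Omega) : bool :=
  Y i (Num.truncn (t / Delta)) w.

Definition transferred (i : 'I_N) (T : R) (w : Omega) : \bar R :=
  (\int[lebesgue_measure]_(t in `[0%R, T])
     (r i * (channel_state i t w)%:R)%:E)%E.

(* The transferred volume is continuous in T, so the infimum is a minimum
   whenever the set is nonempty; it is +oo when the transfer never completes. *)
Definition transfer_time (i : 'I_N) (F : R) (w : Omega) : \bar R :=
  ereal_inf [set T%:E | T in [set T : R | 0 <= T /\
                                          (F%:E <= transferred i T w)%E]].

(* ['E_P[_]] only accepts real-valued variables, and [transfer_time] is +oo on
   a null event. *)
Definition expected_transfer_time (i : 'I_N) (F : R) : \bar R :=
  (\int[P]_w transfer_time i F w)%E.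

Definition static_optimal (F : R) (i : 'I_N) : Prop :=
  forall j, (expected_transfer_time i F <= expected_transfer_time j F)%E.

End channels.

(* Main.v *)
Require Import Defs.
From HB Require Import structures.
From mathcomp Require Import all_boot all_order all_algebra.
From mathcomp Require Import all_classical all_reals all_analysis.
From mathcomp Require Import measurable_realfun.
From mathcomp Require Import ring lra zify.
Import Order.TTheory GRing.Theory Num.Theory.
Import numFieldNormedType.Exports.
Local Open Scope classical_set_scope.
Local Open Scope ring_scope.

(** Let [K.+1] be the number of available slots that a file of size [F] needs on
    channel [i], i.e. the ceiling of [F / (Delta * r i)].  The transfer takes
    [F / r i] of useful time plus [Delta] for each unavailable slot before the
    [K.+1]-st available one.  Slot [n] is such a wasted slot with probability
    [(1 - p i) * q n], where [q n] is the probability of fewer than [K.+1]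
    successes in [n] trials; telescoping the recursion of [q] gives
    [p i * \sum_n q n = K.+1].  Hence
    E[T(i, F)] = F / r i + Delta * K.+1 * (1 - p i) / p i.
    For the numerator of the bound use [K < F / (Delta * r i)]; for the
    denominator drop [F / r istar] and use [K = k]. *)

(** * Probability of few successes in Bernoulli trials *)

(* The probability that [n] Bernoulli(p) trials contain fewer than [K]
   successes, by recursion on the last trial. *)
Fixpoint prob_few_successes (R : realType) (p : R) (n K : nat) : R :=
  match K, n with
  | 0, _ => 0
  | K'.+1, 0 => 1
  | K'.+1, n'.+1 => (1 - p) * prob_few_successes R p n' K'.+1
                    + p * prob_few_successes R p n' K'
  end.
Arguments prob_few_successes {R} p n K.

Lemma prob_few_successes_itv (R : realType) (p : R) n K :
  0 <= p <= 1 -> 0 <= prob_few_successes p n K <= 1.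
Proof.
move=> p01; elim: n K => [|n IHn] [|K] /=; rewrite ?lexx ?ler01//.
move: (IHn K.+1) (IHn K) p01.
set a := prob_few_successes _ _ _; set b := prob_few_successes _ _ _.
by move=> *; nra.
Qed.

(** Both sides are the expectation of min(S, K), with S the number of successes in [M] trials: on
    the left each trial preceded by fewer than [K] successes counts with weight [p], on the right
    P(S > j) is summed over [j < K]. *)
Lemma sum_prob_few_successes (R : realType) (p : R) M K :
  p * (\sum_(0 <= n < M) prob_few_successes p n K) =
  \sum_(j < K) (1 - prob_few_successes p M j.+1).
Proof.
elim: M => [|M IHM].
  rewrite big_nil mulr0; symmetry; apply: big1 => j _.
  by rewrite /= subrr.
rewrite big_nat_recr//= mulrDr IHM.
(* Telescoping in [j], since fewer than 0 successes has probability 0. Each summand then merges with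
   [1 - prob_few_successes p M j.+1] by the recursion. *)
have -> : p * prob_few_successes p M K =
    \sum_(j < K) p * (prob_few_successes p M j.+1 - prob_few_successes p M j).
  rewrite -mulr_sumr -(big_mkord xpredT (fun j =>
    prob_few_successes p M j.+1 - prob_few_successes p M j)) telescope_sumr//.
  by case: M {IHM} => [|M]; rewrite subr0.
rewrite -big_split/=; apply: eq_bigr => j _; ring.
Qed.

(** The finite identity bounds the partial sums by [K / p], so the series converges and its terms
    vanish; no tail estimate is required. *)
Lemma cvg_prob_few_successes (R : realType) (p : R) K : 0 < p <= 1 ->
  prob_few_successes p n K @[n --> \oo] --> (0 : R).
Proof.
move=> /andP[p0 p1]; have p01 : 0 <= p <= 1 by rewrite ltW.
apply: cvg_series_cvg_0; apply: nondecreasing_is_cvgn.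
  apply: nondecreasing_series => n _ _.
  by have /andP[] := prob_few_successes_itv _ p n K p01.
exists (K%:R / p) => _ [M _ <-].
rewrite /series/= ler_pdivlMr// mulrC sum_prob_few_successes.
have -> : (K%:R : R) = \sum_(j < K) 1 by rewrite sumr_const card_ord.
apply: ler_sum => j _; rewrite lerBlDr lerDl.
by have /andP[] := prob_few_successes_itv _ p M j.+1 p01.
Qed.

Lemma nneseries_prob_few_successes (R : realType) (p : R) K : 0 < p <= 1 ->
  (\sum_(0 <= n <oo) (prob_few_successes p n K)%:E = (K%:R / p)%:E)%E.
Proof.
move=> p01; have p0 : 0 < p by case/andP: p01.
apply/cvg_lim => //.
rewrite (_ : (fun _ => _) = EFin \o
    (fun M => p^-1 * \sum_(j < K) (1 - prob_few_successes p M j.+1))); last first.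
  apply/funext => M /=; rewrite -sum_prob_few_successes mulKf ?gt_eqF//.
  by rewrite sumEFin.
apply: cvg_EFin; first exact: nearW.
rewrite mulrC; apply: cvgMr.
have -> : (K%:R : R) = \sum_(j < K) (1 - 0).
  by rewrite subr0 sumr_const card_ord.
apply: cvg_big => [z|j _]; first exact: add_continuous.
by apply: cvgB; [exact: cvg_cst|exact: cvg_prob_few_successes].
Qed.

(** * Counting successes along one sequence *)

Definition successes (y : nat -> bool) (n : nat) : nat :=
  (\sum_(0 <= j < n) y j)%N.

Lemma successesS y n : successes y n.+1 = (successes y n + y n)%N.
Proof. by rewrite /successes big_nat_recr. Qed.

Lemma leq_successes y : {homo successes y : m n / (m <= n)%N}.
Proof.
by apply: homo_leq leq_trans _ => // n; rewrite successesS leq_addr.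
Qed.

(** * Independence and the law of the success count *)

Lemma mutually_independent_comp {R : realType} {d d' : measure_display}
    {Omega : measurableType d} {S : measurableType d'} {P : probability Omega R}
    {I J : choiceType} (X : I -> {RV P >-> S}) (f : J -> I) (f' : I -> J) :
  cancel f f' -> mutually_independent X -> mutually_independent (X \o f).
Proof.
move=> fK indX s A us mA.
(* The left inverse transports the sets indexed by [J] to sets indexed by [I]. *)
have := indX (map f s) (A \o f') _ (fun i => mA _).
rewrite map_inj_uniq//; last exact: can_inj fK.
move=> /(_ us); rewrite big_map !bigcap_seq big_map.
rewrite (eq_bigr (fun j => (X \o f) j @^-1` A j)); last by move=> j _ /=; rewrite fK.
by move=> ->; apply: eq_bigr => j _ /=; rewrite fK.
Qed.

Section bernoulli_sequence.
Context {R : realType} {d : measure_display} {Omega : measurableType d}.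
Context {P : probability Omega R}.
Variables (p : R) (Z : nat -> {RV P >-> bool}).

Let few n K := [set w | (successes (Z ^~ w) n < K)%N].

Let fewS n K : few n.+1 K.+1 =
  few n K.+1 `&` Z n @^-1` [set false] `|` few n K `&` Z n @^-1` [set true].
Proof.
apply/seteqP; split => w /=; rewrite /few /= successesS.
  by case: (Z n w) => /=; [right|left]; split => //; lia.
by case=> -[+ ->] /=; lia.
Qed.

Lemma measurable_preimage_RV_bool (X : {RV P >-> bool}) (A : set bool) :
  measurable (X @^-1` A).
Proof. by rewrite -[X in measurable X]setTI; exact: measurable_funPT. Qed.

Lemma measurable_few_successes n K :
  measurable [set w | (successes (Z ^~ w) n < K)%N].
Proof.
elim: n K => [|n IHn] [|K].
- by rewrite (_ : [set _ | _] = set0)//; apply/seteqP; split => w.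
- rewrite (_ : [set _ | _] = setT)//; apply/seteqP; split => w //= _.
  by rewrite /successes big_nil.
- by rewrite (_ : [set _ | _] = set0)//; apply/seteqP; split => w.
- rewrite -/(few _ _) fewS; apply: measurableU; apply: measurableI;
    by [exact: IHn | exact: measurable_preimage_RV_bool].
Qed.

Hypothesis PZ : forall n, P (Z n @^-1` [set true]) = p%:E /\
                          P (Z n @^-1` [set false]) = (1 - p)%:E.
Hypothesis indZ : mutually_independent Z.

(** The extra events on trials from [n] on strengthen the induction: trial [n] moves into [J], so
    the product formula alone shows that the past count is independent of later trials. *)
Lemma prob_few_successesI n K (J : seq nat) (A : nat -> set bool) :
  uniq J -> all (leq n) J ->
  P ([set w | (successes (Z ^~ w) n < K)%N] `&`
     \bigcap_(j in [set` J]) (Z j @^-1` A j)) =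
  ((prob_few_successes p n K)%:E * \prod_(j <- J) P (Z j @^-1` A j))%E.
Proof.
have few0 m : few m 0 = set0 by apply/seteqP; split => w.
elim: n K J A => [|n IHn] [|K] J A uJ nJ; rewrite -/(few _ _).
- by rewrite few0 set0I measure0 mul0e.
- rewrite (_ : few _ _ = setT) ?setTI.
    by rewrite mul1e; exact: indZ.
  apply/seteqP; split => w //= _.
  by rewrite /few /= /successes big_nil.
- by rewrite few0 set0I measure0 mul0e.
have nJ' : n \notin J.
  by apply/negP => /(allP nJ); rewrite ltnn.
set E := \bigcap_(j in _) _; set Q := (\prod_(j <- J) _)%E.
have mE : measurable E.
  rewrite /E bigcap_seq; apply: bigsetI_measurable => j _.
  exact: measurable_preimage_RV_bool.
have Qfin : Q \is a fin_num by rewrite /Q -indZ//; exact: fin_num_measure.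
have step (L : nat) (b : bool) : P (few n L `&` Z n @^-1` [set b] `&` E) =
    ((prob_few_successes p n L * (if b then p else 1 - p))%:E * Q)%E.
  (* As [n] is not in [J], prescribing the outcome of trial [n] leaves the other events
     unchanged. *)
  have := IHn L (n :: J) (fun j => if j == n then [set b] else A j).
  rewrite /= nJ' uJ leqnn/=.
  rewrite (sub_all _ nJ); last by move=> j /=; exact: ltnW.
  move=> /(_ isT isT); rewrite /E !bigcap_seq !big_cons eqxx setIA.
  have neq j : j \in J -> (j == n) = false.
    by move=> jJ; apply/negP => /eqP jn; move: nJ'; rewrite -jn jJ.
  rewrite (eq_big_seq (fun j => Z j @^-1` A j)); last by move=> j /neq ->.
  rewrite [in RHS](eq_big_seq (fun j => P (Z j @^-1` A j))); last first.
    by move=> j /neq ->.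
  by move=> ->; rewrite EFinM muleA; case: b; rewrite ?(PZ n).1 ?(PZ n).2.
rewrite fewS setIUl measureU; last 3 first.
- by do 2!apply: measurableI => //; [exact: measurable_few_successes|
    exact: measurable_preimage_RV_bool].
- by do 2!apply: measurableI => //; [exact: measurable_few_successes|
    exact: measurable_preimage_RV_bool].
- by apply/seteqP; split => w //= -[[[_ ->] _] [[_]]].
rewrite [X in (X + _)%E]step [X in (_ + X)%E]step -muleDl// -EFinD/=.
by congr (_%:E * _)%E; ring.
Qed.

End bernoulli_sequence.

(** * Transfer along a fixed availability sequence *)

Section deterministic_transfer.
Context {R : realType}.
Variables (Delta c : R) (y : nat -> bool).
Hypotheses (Delta0 : 0 < Delta) (c0 : 0 < c).

Let volume (T : R) : \bar R :=
  (\int[lebesgue_measure]_(t in `[0%R, T])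
     (c * (y (Num.truncn (t / Delta)))%:R)%:E)%E.

Let slot (j : nat) : set R := `[j%:R * Delta, j.+1%:R * Delta[.

Lemma truncn_slot (t : R) j :
  j%:R * Delta <= t < j.+1%:R * Delta -> Num.truncn (t / Delta) = j.
Proof.
by move=> tj; apply: truncn_def; rewrite ler_pdivlMr// ltr_pdivrMr.
Qed.

Lemma slot_truncn (t : R) : 0 <= t ->
  (Num.truncn (t / Delta))%:R * Delta <= t <
  (Num.truncn (t / Delta)).+1%:R * Delta.
Proof.
move=> t0; rewrite -ler_pdivlMr// -ltr_pdivrMr//.
by rewrite truncn_itv// divr_ge0// ltW.
Qed.

Lemma integral_slots n (s : R) : 0 <= s < Delta ->
  volume (n%:R * Delta + s) =
  (c * ((successes y n)%:R * Delta + (y n)%:R * s))%:E.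
Proof.
move=> /andP[s0 sD]; rewrite /volume; set T := _ + s.
have T0 : 0 <= T by rewrite addr_ge0// mulr_ge0// ltW.
(* On [[0, T]] the integrand is a step function; since [s < Delta], slot [n] is the last one met. *)
transitivity (\int[lebesgue_measure]_(t in `[0%R, T])
   \sum_(0 <= j < n.+1) ((c * (y j)%:R)%:E * (\1_(slot j) t)%:E))%E.
  apply: eq_integral => t; rewrite inE/= in_itv/= => /andP[t0 tT].
  have jt := slot_truncn t t0; set j := Num.truncn _ in jt *.
  have jn : (j <= n)%N.
    rewrite -ltnS -(ltr_nat R) -(ltr_pM2r Delta0).
    apply: le_lt_trans (_ : t < _); first by case/andP: jt.
    by rewrite (le_lt_trans tT)// /T -natr1 mulrDl mul1r ltrD2l.
  have jI : j \in index_iota 0 n.+1 by rewrite mem_index_iota.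
  rewrite (bigD1_seq j jI (iota_uniq _ _))/=.
  rewrite indicE mem_set ?mule1; last by rewrite /slot/= in_itv.
  rewrite big1_seq ?adde0// => i /andP[ij _].
  rewrite indicE memNset ?mule0// /slot/= in_itv/= => /truncn_slot ji.
  by move: ij; rewrite -ji eqxx.
have mslot j : measurable (slot j) by exact: measurable_itv.
have cy0 j : (0 <= (c * (y j)%:R)%:E)%E by rewrite lee_fin mulr_ge0// ltW.
rewrite ge0_integral_sum//; last 2 first.
- move=> j; apply: measurable_funeM.
  by apply/measurable_EFinP; apply: measurable_indic; exact: mslot.
- by move=> j t _; rewrite mule_ge0// lee_fin.
have int j : (\int[lebesgue_measure]_(t in `[0%R, T])
   ((c * (y j)%:R)%:E * (\1_(slot j) t)%:E) =
   (c * (y j)%:R)%:E * lebesgue_measure (slot j `&` `[0%R, T]))%E.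
  rewrite ge0_integralZl//; first by rewrite integral_indic//; exact: mslot.
  by apply/measurable_EFinP; apply: measurable_indic; exact: mslot.
rewrite (eq_bigr _ (fun j _ => int j)) big_nat_recr//=.
have -> : slot n `&` `[0%R, T] = `[n%:R * Delta, T]%classic.
  apply/seteqP; split => t; rewrite /slot/= !in_itv/=.
    by case=> /andP[-> _] /andP[].
  move=> /andP[nt tT]; rewrite nt tT/= andbT; split.
    by rewrite (le_lt_trans tT)// /T -natr1 mulrDl mul1r ltrD2l.
  by apply: le_trans nt; rewrite mulr_ge0// ltW.
rewrite (eq_big_nat _ _ (F2 := fun j => (c * (y j)%:R * Delta)%:E)); last first.
  move=> j /andP[_ jn].
  have -> : slot j `&` `[0%R, T] = slot j.
    apply/setIidPl => t; rewrite /slot/= !in_itv/= => /andP[jt tj].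
    have -> : 0 <= t by apply: le_trans jt; rewrite mulr_ge0// ltW.
    apply: (le_trans (ltW tj)); rewrite /T.
    apply: le_trans (_ : n%:R * Delta <= _); last by rewrite lerDl.
    by rewrite ler_pM2r// ler_nat.
  rewrite /slot lebesgue_measure_itv/= lte_fin ltr_pM2r// ltr_nat ltnSn.
  by rewrite -EFinB -EFinM -natr1; congr (_%:E); ring.
rewrite lebesgue_measure_itv/= lte_fin /T ltrDl.
have -> : (if (0 < s)%R then (n%:R * Delta + s)%R%:E - (n%:R * Delta)%R%:E else 0)%E = s%:E.
  case: ltgtP s0 => // [s1 _|<- //]; rewrite -EFinB; congr (_%:E); ring.
rewrite sumEFin -EFinM -EFinD; congr (_%:E).
rewrite /successes natr_sum mulr_suml mulrDr mulr_sumr; congr (_ + _).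
  by apply: eq_bigr => j _; ring.
by ring.
Qed.

(** A file may finish exactly at the end of a slot, so [s = Delta] is also needed; that instant is
    the start of slot [n.+1]. *)
Lemma integral_slots_le n (s : R) : 0 <= s <= Delta ->
  volume (n%:R * Delta + s) =
  (c * ((successes y n)%:R * Delta + (y n)%:R * s))%:E.
Proof.
move=> /andP[s0]; rewrite le_eqVlt => /predU1P[->|sD]; last first.
  by apply: integral_slots; rewrite s0.
have := integral_slots n.+1 0; rewrite lexx => /(_ Delta0).
rewrite successesS natrD mulr0 !addr0 -natr1 !mulrDl !mul1r => ->.
by congr (_%:E); ring.
Qed.

(** The slot in progress is counted as if it were complete. *)
Lemma volume_le_successes (T : R) : 0 <= T ->
  (volume T <= (c * ((successes y (Num.truncn (T / Delta)).+1)%:R * Delta))%:E)%E.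
Proof.
move=> T0; have /andP[nT Tn] := slot_truncn T T0.
set n := Num.truncn _ in nT Tn *.
have -> : T = n%:R * Delta + (T - n%:R * Delta) by ring.
have sD : 0 <= T - n%:R * Delta < Delta by move: Tn; rewrite -natr1; lra.
rewrite integral_slots// lee_fin ler_pM2l// successesS natrD mulrDl lerD2l.
by apply: ler_wpM2l => //; case/andP: sD => _ /ltW.
Qed.

Lemma sum_failures M : (\sum_(0 <= j < M) (~~ y j))%N = (M - successes y M)%N.
Proof.
suff : (\sum_(0 <= j < M) (~~ y j) + successes y M = M)%N by lia.
rewrite /successes -big_split/= (eq_bigr (fun=> 1%N)).
  by rewrite sum_nat_const_nat; lia.
by move=> j _; case: (y j).
Qed.

Lemma successes_leq M : (successes y M <= M)%N.
Proof.
elim: M => [|M IHM]; first by rewrite /successes big_nil.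
by rewrite successesS; case: (y M); lia.
Qed.

(* Until the [K.+1]-th success the clock advances by [F / c] of useful time
   plus one slot per failure; both sides are [+oo] if that success never comes. *)
Lemma transfer_time_slots (F : R) (K : nat) :
  K%:R * Delta * c < F <= K.+1%:R * Delta * c ->
  ereal_inf [set T%:E | T in [set T : R | 0 <= T /\ (F%:E <= volume T)%E]] =
  ((F / c)%:E + Delta%:E *
   \sum_(0 <= n <oo) ((~~ y n && (successes y n < K.+1)%N)%:R%:E))%E.
Proof.
move=> /andP[KF FK].
have F0 : 0 < F by rewrite (le_lt_trans _ KF)// !mulr_ge0// ltW.
pose f n : \bar R := (~~ y n && (successes y n < K.+1)%N)%:R%:E.
have f0 n : (0 <= f n)%E by rewrite lee_fin.
have small M : (successes y M <= K)%N -> c * ((successes y M)%:R * Delta) < F.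
  move=> SK; apply: le_lt_trans KF.
  by rewrite mulrC ler_pM2r// ler_pM2r// ler_nat.
have partial M : (successes y M <= K)%N ->
    (\sum_(0 <= n < M) f n = (M - successes y M)%:R%:E)%E.
  move=> SK; rewrite -sum_failures natr_sum -sumEFin.
  apply: eq_big_nat => j /andP[_ jM]; rewrite /f ltnS.
  by rewrite (leq_trans (leq_successes y _ _ (ltnW jM)) SK) andbT.
(* If the [K.+1]-st success never comes, the infimum is over the empty set, and the failures, at
   least [M - K] among the first [M] slots, are unbounded. *)
have [exK|noK] := pselect (exists n, (K < successes y n)%N); last first.
  have {}noK n : (successes y n <= K)%N.
    by rewrite leqNgt; apply/negP => nK; apply: noK; exists n.
  rewrite (_ : [set T%:E | T in _] = set0); last first.
    apply/seteqP; split => [_ [T [T0 FT] <-]|t []].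
    have := le_trans FT (volume_le_successes T T0).
    by rewrite lee_fin leNgt small.
  rewrite ereal_inf0 (_ : (\sum_(0 <= n <oo) _ = +oo)%E) ?gt0_muley ?lte_fin//.
  apply/eqyP => A A0; pose M := (K + (Num.truncn A).+1)%N.
  apply: le_trans (nneseries_lim_ge M (fun n _ _ => f0 n)).
  rewrite partial// lee_fin (le_trans (ltW (truncnS_gt A)))// ler_nat.
  rewrite leq_subRL; last exact: successes_leq.
  by rewrite leq_add2r noK.
(* By minimality of [n.+1], slot [n] carries the [K.+1]-st success. *)
case: (ex_minnP exK) => -[|n] Kn nmin.
  by move: Kn; rewrite /successes big_nil.
have SnK : successes y n = K /\ y n.
  have : ~~ (K < successes y n)%N.
    by apply/negP => /nmin; rewrite ltnn.
  by move: Kn; rewrite successesS; case: (y n) => /=; lia.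
case: SnK => SnK yn.
have nK : (K <= n)%N by rewrite -SnK successes_leq.
(* Of the [n] slots before slot [n], [K] are successes; slot [n] is no failure, and afterwards the
   count exceeds [K]. *)
have -> : (\sum_(0 <= j <oo) f j = (n - K)%:R%:E)%E.
  rewrite (nneseries_split _ n)// add0n partial ?SnK//.
  rewrite eseries0 ?adde0// => j nj _; rewrite /f.
  case: (ltngtP n j) nj => // [nj _|<-]; last by rewrite yn.
  rewrite [(_ < _)%N](_ : _ = false) ?andbF//; apply/negP.
  by have := leq_successes y _ _ nj; lia.
rewrite -EFinM -EFinD; set Ts := _ + _.
(* The useful time still required in slot [n] after [K] full available slots. *)
pose s := F / c - K%:R * Delta.
have FcE : F = F / c * c by rewrite divfK ?gt_eqF.
have TsE : Ts = n%:R * Delta + s by rewrite /Ts /s natrB//; ring.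
have s0 : 0 < s by rewrite /s subr_gt0 ltr_pdivlMr.
have sD : s <= Delta.
  by rewrite /s lerBlDr ler_pdivrMr//; move: FK; rewrite -natr1; lra.
apply/eqP; rewrite eq_le; apply/andP; split.
  apply: ereal_inf_lbound; exists Ts => //; split.
    by rewrite TsE addr_ge0 ?mulr_ge0// ltW.
  rewrite TsE integral_slots_le ?(ltW s0)// SnK yn mul1r lee_fin.
  by rewrite /s addrC subrK mulrC divfK// gt_eqF.
(* A time [T < Ts] lying before slot [n] has seen at most [K] successes, and one inside slot [n] has
   used less than [s] of it. *)
apply/ereal_infP => _ [T [T0 FT] <-]; rewrite lee_fin leNgt; apply/negP => TTs.
have /andP[mT Tm] := slot_truncn T T0.
have FT' := le_trans FT (volume_le_successes T T0).
move: mT Tm FT'; set m := Num.truncn _ => mT Tm.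
rewrite lee_fin => FT'.
have [mn|nm] := ltnP m n.
  move: FT'; rewrite leNgt small//; rewrite -SnK; exact: leq_successes.
have {}nm : m = n.
  apply/eqP; rewrite eqn_leq nm andbT -ltnS -(ltr_nat R) -(ltr_pM2r Delta0).
  by rewrite (le_lt_trans mT)// (lt_le_trans TTs)// TsE -natr1; lra.
rewrite nm in mT Tm; move: FT.
have -> : T = n%:R * Delta + (T - n%:R * Delta) by ring.
rewrite integral_slots; last by move: Tm; rewrite -natr1; lra.
rewrite lee_fin leNgt SnK yn mul1r [X in _ < X]FcE mulrC ltr_pM2r//.
by move: TTs; rewrite TsE /s; lra.
Qed.

End deterministic_transfer.

(** * Closed form of the expected transfer time *)

Lemma expected_transfer_timeE (R : realType) (d : measure_display)
    (Omega : measurableType d) (P : probability Omega R) (N : nat)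
    (Delta : R) (r p : 'I_N -> R) (Y : 'I_N -> nat -> {RV P >-> bool})
    (i : 'I_N) (F : R) (K : nat) :
  0 < Delta -> 0 < r i -> 0 < p i <= 1 -> iid_bernoulli_channels p Y ->
  K%:R * Delta * r i < F <= K.+1%:R * Delta * r i ->
  expected_transfer_time Delta r Y i F =
  (F / r i + Delta * (K.+1%:R * (1 - p i) / p i))%:E.
Proof.
move=> Delta0 ri0 pi01 [PY indY] KF.
have /andP[pi0 pi1] := pi01.
have pi01' : 0 <= p i <= 1 by rewrite ltW.
have F0 : 0 < F.
  by case/andP: KF => KF _; rewrite (le_lt_trans _ KF)// !mulr_ge0// ltW.
have indYi : mutually_independent (Y i).
  exact: (mutually_independent_comp (fun c => Y c.1 c.2) (pair i) snd).
(* The event that slot [n] is wasted; the singleton intersection matches the form of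
   [prob_few_successesI]. *)
pose B n := [set w | (successes (Y i ^~ w) n < K.+1)%N] `&`
  \bigcap_(j in [set` [:: n]]) (Y i j @^-1` [set false]).
have mB n : measurable (B n).
  apply: measurableI; first exact: measurable_few_successes.
  by rewrite set_cons1 bigcap_set1; exact: measurable_preimage_RV_bool.
have PB n : P (B n) = ((1 - p i)%:E * (prob_few_successes (p i) n K.+1)%:E)%E.
  rewrite /B (prob_few_successesI (p i))//=; last 2 first.
  - by move=> m; have [] := PY i m.
  - by rewrite leqnn.
  by rewrite big_seq1 muleC; congr (_ * _)%E; have [] := PY i n.
rewrite /expected_transfer_time.
transitivity (\int[P]_w ((F / r i)%:E +
    Delta%:E * \sum_(0 <= n <oo) (\1_(B n) w)%:E))%E.
  apply: eq_integral => w _.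
  rewrite /transfer_time /transferred /channel_state.
  rewrite (transfer_time_slots _ _ (Y i ^~ w) Delta0 ri0 _ _ KF).
  congr (_ + _ * _)%E; apply: eq_eseriesr => n _; congr (_%:E).
  rewrite indicE; congr ((nat_of_bool _)%:R); apply/idP/idP.
    move=> /andP[/negbTE Yn Sn]; rewrite inE /B set_cons1 bigcap_set1.
    by split.
  rewrite inE /B set_cons1 bigcap_set1 => -[Sn Yn]; apply/andP; split => //.
  by rewrite Yn.
have mind n : measurable_fun setT (fun w => (\1_(B n) w)%:E : \bar R).
  by apply/measurable_EFinP; apply: measurable_indic.
have mser : measurable_fun setT
    (fun w => (\sum_(0 <= n <oo) (\1_(B n) w)%:E)%E : \bar R).
  by apply: ge0_emeasurable_sum => // n w _ _; rewrite lee_fin.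
have ser0 w : (0 <= \sum_(0 <= n <oo) (\1_(B n) w)%:E :> \bar R)%E.
  by apply: nneseries_ge0 => n _ _; rewrite lee_fin.
rewrite ge0_integralD//; last 3 first.
- by move=> w _; rewrite lee_fin divr_ge0// ltW.
- by move=> w _; rewrite mule_ge0// lee_fin ltW.
- exact: measurable_funeM.
rewrite integral_cst// [X in (_ * X)%E]probability_setT mule1.
rewrite ge0_integralZl//; last by rewrite lee_fin ltW.
(* Nonnegative terms allow exchanging expectation and series. *)
rewrite integral_nneseries//.
rewrite (eq_eseriesr (g := fun n =>
  (1 - p i)%:E * (prob_few_successes (p i) n K.+1)%:E)%E); last first.
  by move=> n _; rewrite integral_indic ?setIT; [exact: PB | | exact: mB].
rewrite nneseriesZl; last first.
  move=> n _; rewrite lee_fin.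
  by have /andP[] := prob_few_successes_itv R (p i) n K.+1 pi01'.
rewrite nneseries_prob_few_successes// -!EFinM -EFinD.
by congr ((_ + _ * _)%:E); ring.
Qed.

(** * Bounding the ratio of expected times *)

Lemma exists_num_slots (R : realType) (a F : R) : 0 < a -> 0 < F ->
  exists K : nat, K%:R * a < F <= K.+1%:R * a.
Proof.
move=> a0 F0.
have exK : exists n : nat, F <= n%:R * a.
  by exists (Num.truncn (F / a)).+1; rewrite -ler_pdivrMr// ltW// truncnS_gt.
case: (ex_minnP exK) => -[|K] FK Kmin.
  by move: FK; rewrite mul0r leNgt F0.
exists K; rewrite FK andbT ltNge; apply/negP => /Kmin.
by rewrite ltnn.
Qed.

Theorem mainTheorem3 (R : realType) (d : measure_display)
    (Omega : measurableType d) (P : probability Omega R)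
    (N : nat) (hN : (2 <= N)%N)
    (Delta : R) (hDelta : 0 < Delta)
    (r p : 'I_N -> R) (hr : forall i, 0 < r i) (hp : forall i, 0 < p i <= 1)
    (Y : 'I_N -> nat -> {RV P >-> bool}) (hY : iid_bernoulli_channels p Y)
    (istar : 'I_N)
    (hstar : forall j, j != istar -> r j * p j < r istar * p istar)
    (hpstar : p istar < 1)
    (F : R) (k : nat)
    (hF : k%:R * Delta * r istar < F < k.+1%:R * Delta * r istar)
    (iso : 'I_N) (hiso : static_optimal Delta r Y F iso) :
  let ET := fun i => expected_transfer_time Delta r Y i F in
  let m := fun i => p i / p istar in
  [/\ forall i, ET i \is a fin_num,
      (0 < ET istar)%E &
      (ET iso / ET istar <=
       (\big[Num.min/1]_(i < N | i != istar)
          ((F / (Delta * r i * p i) + (1 - p i) / p i) /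
           (k.+1%:R * (m i / p i - 1))))%:E)%E].
Proof.
move=> ET m.
have F0 : 0 < F.
  by case/andP: hF => kF _; rewrite (le_lt_trans _ kF)// !mulr_ge0// ltW.
have ps0 : 0 < p istar by case/andP: (hp istar).
(* The expected waiting part of [ET istar], without the useful time [F / r istar]. *)
pose lb := Delta * (k.+1%:R * ((1 - p istar) / p istar)).
have lb0 : 0 < lb.
  by rewrite !mulr_gt0 ?invr_gt0 ?ltr0n ?subr_gt0.
have ETub i : exists2 e, ET i = e%:E &
    e <= Delta * (F / (Delta * r i * p i) + (1 - p i) / p i).
  have /andP[pi0 pi1] := hp i; have ri0 := hr i.
  (* On a general channel [F] may be an exact multiple of [Delta * r i], hence the closed right end
     in [KF]. *)
  have [|K KF] := exists_num_slots _ (Delta * r i) F _ F0; first exact: mulr_gt0.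
  rewrite !mulrA in KF.
  eexists; first exact: (expected_transfer_timeE _ _ _ _ _ _ _ p _ _ _ K).
  have KFr : K%:R * Delta <= F / r i.
    by rewrite ler_pdivlMr// ltW//; case/andP: KF.
  have -> : Delta * (F / (Delta * r i * p i) + (1 - p i) / p i) =
      F / r i + (F / r i + Delta) * ((1 - p i) / p i).
    by field; rewrite !gt_eqF.
  rewrite lerD2l [leLHS](_ : _ = Delta * K.+1%:R * ((1 - p i) / p i)); last first.
    by rewrite !mulrA.
  apply: ler_wpM2r.
    by rewrite divr_ge0 ?subr_ge0// ltW.
  by rewrite -natr1 mulrDr mulr1 lerD2r mulrC.
have [e ETs lbe] : exists2 e, ET istar = e%:E & lb <= e.
  eexists.
    apply: (expected_transfer_timeE _ _ _ _ _ _ _ p _ _ _ k) => //.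
    by case/andP: hF => -> /ltW.
  by rewrite /lb -!mulrA lerDr mulr_ge0// ?invr_ge0 ltW.
have e0 : 0 < e := lt_le_trans lb0 lbe.
split; first by move=> i; have [x ->] := ETub i.
  by rewrite ETs lte_fin.
have [eo ETo _] := ETub iso.
have eole j x : ET j = x%:E -> eo <= x.
  by move=> ETj; rewrite -lee_fin -ETo -ETj; exact: hiso.
rewrite ETs ETo inver gt_eqF// -EFinM lee_fin.
(* The entry 1 follows from optimality of [iso] against [istar]; the entry of channel [i] from its
   optimality against [i]. *)
apply: (big_ind (fun z => eo / e <= z)) => [|x y hx hy|i _].
- by rewrite ler_pdivrMr// mul1r; exact: eole ETs.
- by rewrite le_min hx.
have pi0 : 0 < p i by case/andP: (hp i).
have [x /eole eox xub] := ETub i.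
(* The denominator does not depend on [i]: it equals [lb / Delta]. *)
have -> : m i / p i - 1 = (1 - p istar) / p istar.
  by rewrite /m; field; rewrite !gt_eqF.
set ub := _ + _ in xub *.
apply: (@le_trans _ _ (Delta * ub / lb)); last first.
  have lbD : 0 < lb / Delta by rewrite divr_gt0.
  by rewrite /lb invfM mulrACA divff ?mul1r// gt_eqF.
rewrite ler_pdivrMr// mulrAC ler_pdivlMr//.
apply: ler_pM => //; [|exact: ltW|exact: le_trans xub].
(* Multiplying the two inequalities needs [0 <= eo], which holds because transfer times are
   nonnegative. *)
by rewrite -lee_fin -ETo; apply: integral_ge0 => w _; apply/ereal_infP => _ [T [T0 _] <-].
Qed.
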